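(* Let $r, s, k$ be integers with $0 \le r < s < k$. Let $\mathbf{P}_{kn}$ be the $k$-profile (a column vector in $\mathbb{R}^{k!}$) of a uniformly random permutation in $S_n$, and let $\Pi_r, \Pi_s$ be the orthogonal projections of $\mathbb{R}^{k!}$ onto $V_r$ and $V_s$, respectively. Then $$ E \left[\left( n^{r/2} \,\Pi_r \mathbf{P}_{kn} \right) \left( n^{s/2} \,\Pi_s \mathbf{P}_{kn} \right)^T \right] \; \longrightarrow \; \mathbf{0} \qquad (n \to \infty) $$ in the normed space $\mathbb{R}^{k! \times k!}$.
   Context: **Patterns and profiles.** For $\pi \in S_n$, $k \le n$ and positions $a_1 < \dots < a_k$ in $\{1,\dots,n\}$, the pattern induced by $\pi$ at these positions is the unique $\sigma \in S_k$ with $\sigma(i)<\sigma(j) \iff \pi(a_i)<\pi(a_j)$ for all $i,j$. For $\sigma \in S_k$, $N_\sigma(\pi)$ is the number of $k$-subsets of positions at which $\pi$ induces $\sigma$, and the density of $\sigma$ in $\pi$ is $P_\sigma(\pi) = N_\sigma(\pi)/\binom{n}{k}$. The $k$-profile of $\pi$ is the vector $\mathbf{P}_k(\pi) = (P_\sigma(\pi))_{\sigma \in S_k} \in \mathbb{R}^{k!}$, where $\mathbb{R}^{k!}$ has coordinates indexed by $S_k$. For $\pi$ uniformly distributed in $S_n$, the random vector $\mathbf{P}_k(\pi)$ is denoted $\mathbf{P}_{kn}$ (for $n \ge k$). **Inner product.** $\langle \mathbf{u},\mathbf{v}\rangle = \sum_{\sigma \in S_k} u_\sigma v_\sigma$ on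 $\mathbb{R}^{k!}$; orthogonality is with respect to it. **Representations and the subspaces $V_r$.** A partition $\lambda \vdash k$ is a nonincreasing sequence of positive integers $\lambda_1 \ge \dots \ge \lambda_\ell \ge 1$ with sum $k$. For each $\lambda \vdash k$, $\rho^\lambda$ is the corresponding simple (irreducible) real representation of $S_k$, defined up to similarity: the left action of $S_k$ on $A c_\lambda$, where $A = \mathbb{R}S_k$ is the group algebra and $c_\lambda = \left(\sum_{\sigma \in P_T} \sigma\right)\left(\sum_{\sigma \in Q_T} \mathrm{sign}(\sigma)\sigma\right)$ is the Young symmetrizer of any tableau $T$ of shape $\lambda$ (a filling of the Young diagram of $\lambda$, with row lengths $\lambda_i$, by $1,\dots,k$, each once), $P_T$ and $Q_T$ being the subgroups of permutations preserving each row, respectively each column, of $T$. Thus $\lambda=(k)$ gives the trivial representation and $\lambda = (1,\dots,1)$ the sign representation. Let $d_\lambda = \dim \rho^\lambda$. If $\rho^\lambda$ is given by real matrices $R^\lambda(\sigma) \in \mathbb{R}^{d_\lambda\times d_\lambda}$, $\sigma \in S_k$, its matrix elements are the vectors $\mathbf{R}^\lambda_{ij} = (R^\lambda_{ij}(\sigma))_{\sigma \in S_k} \in \mathbb{R}^{k!}$, $1 \le i,j \le d_\lambda$; their span does not depend on the choice of matrices. For $r \in \{0,\dots,k-1\}$, $$V_r := \mathrm{span}\{\mathbf{R}^\lambda_{ij} : \lambda \vdash k,\ \lambda_1 = k-r,\ 1\le i,j\le d_\lambda\}.$$ The subspaces $V_0,\dots,V_{k-1}$ are mutually orthogonal and $\mathbb{R}^{k!}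 = V_0 \oplus \dots \oplus V_{k-1}$; $\Pi_r : \mathbb{R}^{k!} \to V_r$ is the orthogonal projection. *)

(* Defs.v *)
From HB Require Import structures.
From mathcomp Require Import all_boot all_order all_algebra all_fingroup.
From mathcomp Require Import sesquilinear mxrepresentation.
From mathcomp Require Import all_classical all_reals all_analysis.

Set Implicit Arguments.
Unset Strict Implicit.
Unset Printing Implicit Defensive.

Import Order.TTheory GRing.Theory Num.Theory.
Import numFieldNormedType.Exports.

Local Open Scope ring_scope.

(* [a] lists the positions a_1 < ... < a_k: the increasing maps 'I_k -> 'I_n   *)
(* are in bijection with the k-subsets of positions.                          *)
Definition increasing (k n : nat) (a : {ffun 'I_k -> 'I_n}) : bool :=
  [forall i : 'I_k, forall j : 'I_k, (i < j)%N ==> (a i < a j)%N].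

Definition induces (k n : nat) (pi : 'S_n) (a : {ffun 'I_k -> 'I_n})
    (sigma : 'S_k) : bool :=
  [forall i : 'I_k, forall j : 'I_k,
     (sigma i < sigma j)%N == (pi (a i) < pi (a j))%N].

Definition num_occ (k n : nat) (sigma : 'S_k) (pi : 'S_n) : nat :=
  #|[set a : {ffun 'I_k -> 'I_n} | increasing a && induces pi a sigma]|.

Definition density (R : realType) (k n : nat) (sigma : 'S_k) (pi : 'S_n) : R :=
  (num_occ sigma pi)%:R / 'C(n, k)%:R.

(* The coordinates of R^(k!) are indexed by 'S_k through [enum_val].          *)
Definition profile (R : realType) (k n : nat) (pi : 'S_n) :
    'cV[R]_#|{perm 'I_k}| :=
  \col_x density R (enum_val x) pi.

Definition uniform_mean (R : realType) (n : nat) (W : lmodType R)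
    (X : 'S_n -> W) : W :=
  (n`!%:R)^-1 *: \sum_(pi : 'S_n) X pi.

Definition is_partition (k : nat) (la : seq nat) : bool :=
  [&& sorted geq la, all (leq 1) la & sumn la == k].

(* A tableau is the list of its rows. Any tableau of shape la may be used to  *)
(* define the representation attached to la; this is the row-reading one.     *)
Definition tableau (k : nat) (la : seq nat) : seq (seq 'I_k) :=
  reshape la (enum 'I_k).

Lemma tableauP (k : nat) (la : seq nat) : is_partition k la ->
  shape (tableau k la) = la /\ perm_eq (flatten (tableau k la)) (enum 'I_k).
Proof.
case/and3P => _ _ /eqP sumla.
by rewrite /tableau reshapeKl ?reshapeKr ?size_enum_ord ?sumla.
Qed.

Definition columns (k : nat) (T : seq (seq 'I_k)) : seq (seq 'I_k) :=
  [seq pmap (fun row => onth row j) T | j <- iota 0 k].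

Definition preservers (k : nat) (B : seq (seq 'I_k)) : {set 'S_k} :=
  [set g : 'S_k | all (fun b => all (fun x => g x \in b) b) B].

(* Products of permutations: (g * h)%g is "g, then h", that is h \o g. Hence  *)
(* the product p q = p \o q of the Young symmetrizer is (q * p)%g, and left   *)
(* multiplication by g in the group algebra is the right regular              *)
(* representation [regular_repr], which acts on row vectors.                  *)
Definition young_symmetrizer (R : realType) (k : nat) (T : seq (seq 'I_k)) :
    'rV[R]_#|[set: 'S_k]%G| :=
  \sum_(p in preservers T) \sum_(q in preservers (columns T))
    (-1) ^+ odd_perm q *: delta_mx 0 (gring_index [set: 'S_k]%G (q * p)%g).

(* rho^la: the action of 'S_k on the left ideal A c_la, i.e. on the submodule *)
(* of the regular representation generated by c_la. Its matrices act on row   *)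
(* vectors, so they are the transposes of those acting on column vectors;     *)
(* this does not change the set of matrix elements.                           *)
Definition rho (R : realType) (k : nat) (la : seq nat) :=
  submod_repr (cyclic_mx_module (regular_repr R [set: 'S_k]%G)
                 (young_symmetrizer R (tableau k la))).

Definition matrix_element (R : realType) (k : nat) (la : seq nat) i j :
    'rV[R]_#|{perm 'I_k}| :=
  \row_x rho R k la (enum_val x) i j.

(* V_r is the row space of [Vsub R k r]. The index type k.-bseq 'I_k.+1        *)
(* contains every partition of k exactly once: it has at most k parts, each   *)
(* at most k.                                                                 *)
Definition Vsub (R : realType) (k r : nat) : 'M[R]_#|{perm 'I_k}| :=
  (\sum_(la : k.-bseq 'I_k.+1 | is_partition k (map val la)
                                && (head 0 (map val la) == k - r)%N)
     \sum_i \sum_j <<@matrix_element R k (map val la) i j>>)%MS.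

(* Orthogonal projection onto the row space of U, as a matrix acting on       *)
(* column vectors; [orthomx idfun 1%:M U] is the orthogonal complement of U.  *)
Definition orth_proj (R : realType) (N : nat) (U : 'M[R]_N) : 'M[R]_N :=
  (proj_mx U (orthomx idfun 1%:M U))^T.

Lemma orth_projP (R : realType) (N : nat) (U : 'M[R]_N) (u : 'cV[R]_N) :
  ((orth_proj U *m u)^T <= U)%MS
  /\ forall v : 'rV[R]_N, (v <= U)%MS -> v *m (u - orth_proj U *m u) = 0.
Proof.
have dot0 (w : 'rV[R]_N) : w *m w^T = 0 -> w = 0.
  move=> /matrixP/(_ 0 0); rewrite !mxE => /eqP.
  rewrite psumr_eq0 => [/allP w0|j _]; last by rewrite mxE -expr2 sqr_ge0.
  apply/rowP => j; rewrite mxE; apply/eqP.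
  by have := w0 j (mem_index_enum j); rewrite !mxE mulf_eq0 orbb.
have perpP m (w : 'M[R]_(m, N)) :
    (w <= orthomx idfun 1%:M U)%MS = (w *m U^T == 0).
  by rewrite sub_kermx mul1mx map_mx_id.
have cap0 : (U :&: orthomx idfun 1%:M U = 0)%MS.
  apply/eqP/rowV0P => w; rewrite sub_capmx perpP => /andP[/submxP[x ->]] /eqP w0.
  by apply: dot0; rewrite trmx_mul mulmxA w0 mul0mx.
have sum1 : (1%:M <= U + orthomx idfun 1%:M U)%MS.
  rewrite sub1mx /row_full eqn_leq rank_leq_row /=.
  have /eqP -> : \rank (U + orthomx idfun 1%:M U) ==
      (\rank U + \rank (orthomx idfun 1%:M U))%N.
    by rewrite -mxrank_sum_cap cap0 mxrank0 addn0.
  have -> : \rank (orthomx idfun 1%:M U) = (N - \rank U)%N.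
    by rewrite mxrank_ker mul1mx map_mx_id // mxrank_tr.
  by rewrite subnKC // rank_leq_row.
rewrite /orth_proj; split; first by rewrite trmx_mul trmxK proj_mx_sub.
move=> v /submxP[x ->]; apply: (can_inj (@trmxK _ _ _)).
rewrite trmx0 -mulmxA trmx_mul trmx_mul linearB /= trmx_mul trmxK.
have := proj_mx_compl_sub (submx_trans (submx1 u^T) sum1).
by rewrite perpP => /eqP ->; rewrite mul0mx.
Qed.

(* Main.v *)
Require Import Defs.
From mathcomp Require Import all_boot all_order all_algebra all_fingroup.
From mathcomp Require Import mxrepresentation.
From mathcomp Require Import all_classical all_reals all_analysis.
From mathcomp Require Import zify ring lra.

(* Only the membership of the columns of [orth_proj (Vsub R k s)] in V_s      *)
(* matters, for the larger index s. A Young symmetrizer of shape la is        *)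
(* annihilated by the sum over the symmetric group of any set D of more than  *)
(* la_1 points, because by pigeonhole D contains two points of one column,    *)
(* whose transposition changes the sign; so each v in V_s sums to 0 over the  *)
(* cosets of Sym D when #|D| > k - s. Expand E[P_sigma <P, v>] over pairs     *)
(* (a, b) of k-sets of positions. If they share fewer than s positions,       *)
(* permuting those of b outside a preserves the law and the pattern at a,     *)
(* hence averages v over such a coset and the pair contributes 0. The other   *)
(* pairs have proportion O(n^-s), and n^((r+s)/2 - s) tends to 0 since r < s. *)

Set Implicit Arguments.
Unset Strict Implicit.
Unset Printing Implicit Defensive.

Import Order.TTheory GRing.Theory Num.Theory.
Import numFieldNormedType.Exports.

Local Open Scope ring_scope.

(** Representation theory enters through [sum_Sym_columns] and [Vsub_sum_Sym], which turn membership
    in V_s into vanishing coset sums. By [sum_induces_eq0] these kill every pair of k-sets of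
    positions sharing fewer than s positions. By [card_overlap], O(n^(2k-s)) pairs remain out of
    order n^(2k), so [density_moment_le] gives E[P_sigma <P, v>] = O(n^-s) for v in V_s. Pi_r
    contributes a fixed linear combination of the coordinates P_sigma, and the scaling is at most
    n^(s - 1/2) by [powR_half_mul], so each entry is O(n^(-1/2)). *)

(** * Columns of a tableau and sign cancellation *)

Lemma preserversM (k : nat) (B : seq (seq 'I_k)) (g h : 'S_k) :
  g \in preservers B -> h \in preservers B -> (g * h)%g \in preservers B.
Proof.
rewrite !inE => /allP gB /allP hB; apply/allP => b bB; apply/allP => x xb.
by rewrite permM; move/allP: (hB b bB); apply; move/allP: (gB b bB); apply.
Qed.

Lemma uniq_flatten_row (T : eqType) (S : seq (seq T)) (r1 r2 : seq T) (x : T) :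
  uniq (flatten S) -> r1 \in S -> r2 \in S -> x \in r1 -> x \in r2 -> r1 = r2.
Proof.
elim: S => //= r S IH; rewrite cat_uniq => /and3P[_ /hasPn rS uS].
have notin r' : r' \in S -> x \in r' -> x \notin r.
  by move=> r'S xr'; apply: rS; apply/flattenP; exists r'.
rewrite !inE => /predU1P[->|r1S] /predU1P[->|r2S] // xr1 xr2; last exact: IH.
- by have := notin _ r2S xr2; rewrite xr1.
- by have := notin _ r1S xr1; rewrite xr2.
Qed.

Lemma uniq_flatten_mem (T : eqType) (S : seq (seq T)) (r : seq T) :
  uniq (flatten S) -> r \in S -> uniq r.
Proof.
elim: S => //= r' S IH; rewrite cat_uniq => /and3P[ur' _ uS].
by rewrite inE => /predU1P[->|/(IH uS)].
Qed.

(** In a filling without repetition an entry has one row and one index in it, and this index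
    determines its column. Entries with equal indices thus belong to the same column, which their
    exchange preserves. *)
Lemma tperm_column (k : nat) (T : seq (seq 'I_k)) (r1 r2 : seq 'I_k)
    (i j : 'I_k) :
  uniq (flatten T) -> r1 \in T -> r2 \in T -> i \in r1 -> j \in r2 ->
  index i r1 = index j r2 -> tperm i j \in preservers (columns T).
Proof.
move=> uT r1T r2T ir1 jr2 eqij.
have inb (x y : 'I_k) (rx ry : seq 'I_k) (c : nat) :
    rx \in T -> ry \in T -> x \in rx -> y \in ry ->
    index x rx = index y ry ->
    x \in pmap (fun row => onth row c) T ->
    y \in pmap (fun row => onth row c) T.
  move=> rxT ryT xrx yry eqxy; rewrite !mem_pmap => /mapP[r rT xc].
  have cr : (c < size r)%N.
    by rewrite ltnNge; apply/negP => /onth_default cr; rewrite cr in xc.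
  have xE : x = nth x r c by rewrite (onth_nth _ _ _ _ (esym xc)).
  have xr : x \in r by rewrite xE mem_nth.
  have rE := uniq_flatten_row uT rT rxT xr xrx.
  have cE : c = index x rx.
    by rewrite -rE xE index_uniq // (uniq_flatten_mem uT).
  apply/mapP; exists ry => //.
  by rewrite cE eqxy onthE (nth_map y) ?index_mem // nth_index.
rewrite inE; apply/allP => _ /mapP[c _ ->]; apply/allP => x.
case: tpermP => [->|->|_ _ //].
- exact: inb eqij.
- exact: inb (esym eqij).
Qed.

(** Pigeonhole: the column number [c] takes fewer than #|D| values, since the first row is the
    longest. *)
Lemma column_collision (k : nat) (la : seq nat) (D : {set 'I_k}) :
  is_partition k la -> (head 0 la < #|D|)%N ->
  exists i j, [/\ i \in D, j \in D, i != j &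
    tperm i j \in preservers (columns (tableau k la))].
Proof.
move=> laP ltD; have [shT permT] := tableauP laP.
set T := tableau k la in shT permT *.
have uT : uniq (flatten T) by rewrite (perm_uniq permT) enum_uniq.
have rowP z : {r | r \in T & z \in r}.
  apply/sig2W; have : z \in flatten T by rewrite (perm_mem permT) mem_enum.
  by move/flattenP => [r rT zr]; exists r.
pose row z := s2val (rowP z); pose c z := index z (row z).
have rowT z : row z \in T := s2valP (rowP z).
have inrow z : z \in row z := s2valP' (rowP z).
have clt z : (c z < head 0 la)%N.
  apply: (@leq_trans (size (row z))); first by rewrite index_mem.
  have : size (row z) \in la by rewrite -shT; exact: map_f.
  case/and3P: laP => + _ _; case: (la) => //= l0 la' sla.
  rewrite inE => /predU1P[->//|/(allP (order_path_min _ sla))]; apply.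
  by move=> ? ? ? /[swap]; exact: leq_trans.
have [|/dinjectivePn] := boolP (dinjectiveb c D).
  move=> /dinjectiveP injc; suff : (#|D| <= head 0 la)%N by rewrite leqNgt ltD.
  rewrite cardE -(size_map c) -(size_iota 0 (head 0 la)); apply: uniq_leq_size.
    rewrite map_inj_in_uniq ?enum_uniq // => x y.
    by rewrite !mem_enum; exact: injc.
  by move=> _ /mapP[z _ ->]; rewrite mem_iota /=.
case=> i iD [j /andP[/= nij jD] cij]; exists i, j; split => //.
  by rewrite eq_sym.
exact: (tperm_column uT (rowT i) (rowT j) (inrow i) (inrow j) cij).
Qed.

(** A sign-reversing substitution: for a transposition t in [Sym D] whose conjugate t' = x t x^-1 is
    a column transposition, replacing g by t g and q by q t' fixes q x g and flips the sign of q.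
    Hence the sum equals its opposite. *)
Lemma sum_Sym_columns (R : realType) (W : lmodType R) (k : nat) (la : seq nat)
    (D : {set 'I_k}) (x : 'S_k) (F : 'S_k -> W) :
  is_partition k la -> (head 0 la < #|D|)%N ->
  \sum_(g in Sym D) \sum_(q in preservers (columns (tableau k la)))
    (-1) ^+ odd_perm q *: F (q * x * g)%g = 0.
Proof.
move=> laP ltD.
(* The collision is sought in the preimage of D under x, where the conjugate t' moves its two
   points. *)
have ltD' : (head 0 la < #|[set (x^-1)%g i | i in D]|)%N.
  by rewrite card_imset //; exact: perm_inj.
have [_ [_ [/imsetP[i iD ->] /imsetP[j jD ->] nij tC]]] :=
  column_collision laP ltD'.
set C := preservers _ in tC *.
have {}nij : i != j by apply: contraNneq nij => ->.
have tE : (x * tperm i j = tperm (x^-1 i) (x^-1 j) * x)%g.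
  by rewrite -tpermJ conjgE invgK !mulgA mulgKV.
have tD : tperm i j \in Sym D.
  rewrite inE; apply/fintype.subsetP => z; rewrite inE.
  by case: tpermP => [->|->|_ _ /eqP].
have CM q : ((q * tperm (x^-1 i) (x^-1 j))%g \in C) = (q \in C).
  apply/idP/idP => [qtC|qC]; last exact: preserversM.
  rewrite -[q]mulg1 -(tperm2 (x^-1 i)%g (x^-1 j)%g) mulgA.
  exact: preserversM.
set S := LHS; suff SN : S = - S.
  have : 2%:R *: S = 0 by rewrite scaler_nat mulr2n {1}SN addNr.
  by move/eqP; rewrite scaler_eq0 pnatr_eq0 => /eqP.
rewrite {1}/S (reindex_inj (mulgI (tperm i j))) /= /S -sumrN.
apply: eq_big => [g|g _]; first by rewrite groupMl.
rewrite (reindex_inj (mulIg (tperm (x^-1 i) (x^-1 j))%g)) /= -sumrN.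
apply: eq_big => [q|q _]; first exact: CM.
rewrite odd_permM odd_tperm (inj_eq perm_inj) nij addbT signrN scaleNr.
congr (- (_ *: F _)).
by rewrite -!mulgA; congr mulg; rewrite !mulgA -tE -!mulgA tpermKg.
Qed.

(** * Vanishing coset sums on V_r *)

(** Right multiplication by the sum over [Sym D] kills every translate of the Young symmetrizer,
    hence the whole submodule generated by it. *)
Lemma rho_sum_Sym (R : realType) (k : nat) (la : seq nat) (D : {set 'I_k}) :
  is_partition k la -> (head 0 la < #|D|)%N ->
  \sum_(g in Sym D) rho R k la g = 0.
Proof.
move=> laP ltD; pose rG := regular_repr R [set: 'S_k]%G.
pose u := young_symmetrizer R (tableau k la).
have deltaM y h : delta_mx 0 (gring_index [set: 'S_k]%G y) *m rG h =
    delta_mx 0 (gring_index [set: 'S_k]%G (y * h)%g) :> 'rV_ _.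
  by rewrite -rowE rowK gring_indexK.
have uS h : u *m rG h *m (\sum_(g in Sym D) rG g) = 0.
  rewrite mulmx_sumr; under eq_bigr => g gD.
    rewrite -mulmxA -repr_mxM ?inE // /u /young_symmetrizer mulmx_suml.
    under eq_bigr => p _.
      rewrite mulmx_suml; under eq_bigr => q _.
        rewrite -scalemxAl deltaM -mulgA [(p * _)%g]mulgA mulgA.
        over.
      over.
    over.
  (* For each row permutation p, what remains is the signed column sum with x = p h. *)
  rewrite exchange_big big1 //= => p _.
  exact: (sum_Sym_columns (p * h)%g
    (fun y => delta_mx 0 (gring_index [set: 'S_k]%G y)) laP ltD).
have US : cyclic_mx rG u *m (\sum_(g in Sym D) rG g) = 0.
  apply/eqP; rewrite -sub_kermx; apply/rV_subP => v /cyclic_mxP[A EA ->].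
  rewrite sub_kermx; move: EA => /envelop_mxP[a ->].
  rewrite [u *m _]mulmx_sumr mulmx_suml big1 // => h _.
  by rewrite -scalemxAr -scalemxAl uS scaler0.
pose U := cyclic_mx rG u.
have -> : \sum_(g in Sym D) rho R k la g =
    in_submod U (val_submod 1%:M *m (\sum_(g in Sym D) rG g)).
  by rewrite mulmx_sumr linear_sum.
have VU := @val_submodP _ _ U _ 1%:M.
have [A ->] := submxP VU.
by rewrite -mulmxA US mulmx0 linear0.
Qed.

(** The sum is a linear functional of v, so matrix elements suffice; there rho(g t) = rho(g) rho(t)
    reduces it to an entry of 0 times rho(t). *)
Lemma Vsub_sum_Sym (R : realType) (k r : nat) (v : 'rV[R]_#|{perm 'I_k}|)
    (D : {set 'I_k}) (t : 'S_k) :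
  (v <= Vsub R k r)%MS -> (k - r < #|D|)%N ->
  \sum_(g in Sym D) v 0 (enum_rank (g * t)%g) = 0.
Proof.
move=> vV ltD.
pose w : 'cV[R]_#|{perm 'I_k}| :=
  \sum_(g in Sym D) delta_mx (enum_rank (g * t)%g) 0.
have wE u : u *m w = (\sum_(g in Sym D) u 0 (enum_rank (g * t)%g))%:M.
  apply/rowP => j; rewrite ord1 mulmx_sumr summxE mxE eqxx mulr1n.
  by apply: eq_bigr => g _; rewrite -colE mxE.
suff : (Vsub R k r <= kermx w)%MS.
  move=> /(submx_trans vV); rewrite sub_kermx wE => /eqP/matrixP/(_ 0 0).
  by rewrite !mxE.
apply/sumsmx_subP => la /andP[laP /eqP hla]; apply/sumsmx_subP => i _.
apply/sumsmx_subP => j _; rewrite genmxE sub_kermx wE; apply/eqP.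
have {}ltD : (head 0 (map val la) < #|D|)%N by rewrite hla.
rewrite (_ : \sum_(g in _) _ = 0) ?raddf0 //.
have := rho_sum_Sym R laP ltD.
move=> /(congr1 (mulmx^~ (rho R k (map val la) t))).
rewrite mul0mx mulmx_suml => /matrixP/(_ i j); rewrite summxE mxE => rho0.
rewrite -[RHS]rho0; apply: eq_bigr => g _.
by rewrite mxE enum_rankK repr_mxM ?inE.
Qed.

(** * Pairs of position sets with small overlap *)

(** Transports g along b to a permutation of all positions. The second property makes it fix the
    positions of a when g moves only indices whose positions under b lie outside a. *)
Lemma extend_perm (k n : nat) (b : {ffun 'I_k -> 'I_n}) (g : 'S_k) :
  injective b ->
  exists h : 'S_n, (forall i, h (b i) = b (g i)) /\
    (forall x, (forall i, b i = x -> g i = i) -> h x = x).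
Proof.
move=> injb.
pose f x := if [pick i | b i == x] is Some i then b (g i) else x.
have fb i : f (b i) = b (g i).
  rewrite /f; case: pickP => [j /eqP/injb -> //|/(_ i)]; by rewrite eqxx.
have fN x : (forall i, b i != x) -> f x = x.
  by move=> bN; rewrite /f; case: pickP => // j; rewrite (negPf (bN j)).
have fP x : (exists i, x = b i) \/ (forall i, b i != x).
  case: (pickP [pred i | b i == x]) => [i /eqP <-|N]; first by left; exists i.
  by right => i; have /= -> := N i.
have injf : injective f.
  move=> x y; case: (fP x) => [[i ->]|xN]; case: (fP y) => [[j ->]|yN].
  - by rewrite !fb => /injb/perm_inj ->.
  - by rewrite fb (fN y) // => /eqP; rewrite (negPf (yN _)).
  - by rewrite fb (fN x) // => /esym/eqP; rewrite (negPf (xN _)).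
  - by rewrite !fN.
exists (perm injf); split=> [i|x xg]; rewrite permE ?fb //.
case: (fP x) => [[i xE]|/fN //].
by rewrite xE fb xg.
Qed.

Lemma increasing_inj (k n : nat) (a : {ffun 'I_k -> 'I_n}) :
  increasing a -> injective a.
Proof.
move=> /forallP inca i j aij; apply/val_inj/eqP.
have incr (x y : 'I_k) : (x < y)%N -> (a x < a y)%N.
  by have /forallP/(_ y)/implyP := inca x.
by case: (ltngtP (val i) (val j)) => // /incr; rewrite aij ltnn.
Qed.

(* Permuting by [h] the positions of [b] that are not positions of [a] moves  *)
(* the pattern at [b] within a coset of [Sym D], and not the one at [a].      *)
Lemma sum_induces_eq0 (R : realType) (k n : nat) (v : 'S_k -> R)
    (a b : {ffun 'I_k -> 'I_n}) (sigma : 'S_k) (D : {set 'I_k}) :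
  (forall t, \sum_(g in Sym D) v (g * t)%g = 0) ->
  injective b -> (forall i j, b i = a j -> i \notin D) ->
  \sum_(pi : 'S_n) (induces pi a sigma)%:R *
    (\sum_(tau : 'S_k) (induces pi b tau)%:R * v tau) = 0.
Proof.
move=> v0 injb bD; set G := LHS.
have GE g : g \in Sym D -> G = \sum_(pi : 'S_n) (induces pi a sigma)%:R *
    (\sum_(tau : 'S_k) (induces pi b tau)%:R * v (g * tau)%g).
  rewrite inE => gD; have [h [hb hfix]] := extend_perm g injb.
  rewrite /G (reindex_inj (mulgI h)) /=; apply: eq_bigr => pi _.
  have ha i : h (a i) = a i.
    by apply: hfix => j /bD jD; exact: out_perm gD jD.
  congr (_%:R * _).
    congr nat_of_bool; apply: eq_forallb => i; apply: eq_forallb => j.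
    by rewrite !permM !ha.
  rewrite (reindex_inj (mulgI g)) /=; apply: eq_bigr => tau _.
  congr (_%:R * _); congr nat_of_bool; apply/forallP/forallP => H i.
    apply/forallP => j; have /forallP/(_ (g^-1%g j)) := H (g^-1%g i).
    by rewrite !permM !hb !permKV.
  apply/forallP => j; have /forallP/(_ (g j)) := H (g i).
  by rewrite !permM !hb.
(* Summing the expressions [GE] over [Sym D] yields #|Sym D| times G on one side and coset sums of
   v, all zero, on the other. *)
have : \sum_(g in Sym D) G = 0.
  rewrite (eq_bigr _ GE) exchange_big big1 //= => pi _.
  rewrite -mulr_sumr exchange_big big1 ?mulr0 //= => tau _.
  by rewrite -mulr_sumr v0 mulr0.
rewrite sumr_const => /eqP; rewrite mulrn_eq0 => /orP[|/eqP //].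
rewrite cards_eq0 => /eqP S0.
by have := group1 (Sym_group D); rewrite /= S0 inE.
Qed.

(** * Counting the remaining pairs and bounding moments *)

(** Choose the set D of indices sent into a (at most 2^k ways), their images (at most k each), and
    the images of the at most k - s other indices (n each). *)
Lemma card_overlap (k n s : nat) (a : {ffun 'I_k -> 'I_n}) : (0 < n)%N ->
  (#|[set b : {ffun 'I_k -> 'I_n} |
      (s <= #|[set i | b i \in codom a]|)%N]|
    <= 2 ^ k * (k ^ k * n ^ (k - s)))%N.
Proof.
move=> n0.
pose A (D : {set 'I_k}) i := [pred x | (i \in D) ==> (x \in codom a)].
have leq_expn m d : (d <= m -> m ^ d <= m ^ m)%N.
  by case: m => [|m]; [rewrite leqn0 => /eqP -> | exact: leq_pexp2l].
have cardA (D : {set 'I_k}) : (s <= #|D|)%N ->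
    (#|family (A D)| <= k ^ k * n ^ (k - s))%N.
  move=> sD; rewrite card_family foldrE big_map big_enum /=.
  rewrite (bigID (mem D)) /=; apply: leq_mul.
    apply: (@leq_trans (k ^ #|D|)).
      rewrite -prod_nat_const; apply: leq_prod => i iD.
      rewrite -[leqRHS]card_ord (leq_trans _ (leq_image_card a _)) //.
      by apply/subset_leq_card/fintype.subsetP => x /implyP; exact.
    by apply: leq_expn; rewrite -[leqRHS]card_ord max_card.
  apply: (@leq_trans (n ^ #|~: D|)).
    rewrite -prod_nat_const [leqRHS](eq_bigl [pred i | i \notin D]) => [|i].
      by apply: leq_prod => i _; rewrite -[leqRHS]card_ord max_card.
    by rewrite !inE.
  by rewrite leq_pexp2l // cardsCs finset.setCK card_ord leq_sub2l.
pose F (D : {set 'I_k}) :=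
  if (s <= #|D|)%N then [set b in family (A D)] else finset.set0.
apply: (@leq_trans #|\bigcup_(D : {set 'I_k}) F D|).
  apply/subset_leq_card/fintype.subsetP => b; rewrite inE => sb.
  apply/finset.bigcupP; exists [set i | b i \in codom a] => //.
  rewrite /F sb inE.
  by apply/familyP => i; rewrite !inE; case: (b i \in _).
apply: leq_trans (unstable.card_big_setU _ _ _) _.
have -> : (2 ^ k = #|{set 'I_k}|)%N.
  by rewrite -cardsT -powersetT card_powerset cardsT card_ord.
rewrite -sum_nat_const; apply: leq_sum => D _; rewrite /F.
by case: ifP => [/cardA|_]; rewrite ?cards0 // cardsE.
Qed.

(** Residuals are orthogonal to projections, so P^T (1 - P) = 0, and P^T = P^T P is symmetric. *)
Lemma tr_orth_proj (R : realType) (N : nat) (U : 'M[R]_N) :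
  (orth_proj U)^T = orth_proj U.
Proof.
set P := orth_proj U.
have P0 : P^T *m (1%:M - P) = 0.
  apply/matrixP => i j.
  have [Pi _] := orth_projP U (delta_mx i 0).
  have [_ /(_ _ Pi)] := orth_projP U (delta_mx j 0).
  rewrite -/P => /matrixP/(_ 0 0); rewrite !mxE => P0; rewrite -[RHS]P0.
  by apply: eq_bigr => l _; rewrite -!colE !mxE eqxx andbT.
move: P P0 => P /eqP; rewrite mulmxBr mulmx1 subr_eq0 => /eqP PE.
by have /= := congr1 trmx PE; rewrite trmxK trmx_mul trmxK -PE.
Qed.

Lemma num_occE (R : realType) (k n : nat) (sigma : 'S_k) (pi : 'S_n) :
  (num_occ sigma pi)%:R =
    \sum_(a : {ffun 'I_k -> 'I_n} | increasing a) (induces pi a sigma)%:R :> R.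
Proof.
rewrite /num_occ -sum1_card natr_sum.
rewrite [LHS](eq_bigl (fun a => increasing a && induces pi a sigma)) => [|a].
  by rewrite big_mkcondr /=; apply: eq_bigr => a _; case: induces.
by rewrite inE.
Qed.

(** Expanding both counts gives a sum over pairs (a, b). Each term is at most n! times the l1 norm
    of v, and it vanishes unless b belongs to [B a]. *)
Lemma num_occ_moment_le (R : realType) (k n s : nat) (v : 'S_k -> R)
    (sigma : 'S_k) :
  (0 < n)%N -> (s <= k)%N ->
  (forall (D : {set 'I_k}) t, (k - s < #|D|)%N ->
    \sum_(g in Sym D) v (g * t)%g = 0) ->
  `|\sum_(pi : 'S_n) (num_occ sigma pi)%:R *
      (\sum_tau (num_occ tau pi)%:R * v tau)|
  <= (n ^ k * (2 ^ k * (k ^ k * n ^ (k - s))))%:R *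
    (n`!%:R * \sum_tau `|v tau|).
Proof.
move=> n0 sk v0.
pose V := n`!%:R * \sum_tau `|v tau|.
pose G (a b : {ffun 'I_k -> 'I_n}) := \sum_(pi : 'S_n) (induces pi a sigma)%:R *
    (\sum_(tau : 'S_k) (induces pi b tau)%:R * v tau).
have -> : \sum_(pi : 'S_n) (num_occ sigma pi)%:R *
      (\sum_tau (num_occ tau pi)%:R * v tau) =
    \sum_(a | increasing a) \sum_(b | increasing b) G a b.
  rewrite /G.
  under [RHS]eq_bigr => b _ do rewrite exchange_big /=.
  rewrite [RHS]exchange_big /=; apply: eq_bigr => pi _.
  under [RHS]eq_bigr => b _ do rewrite -mulr_sumr.
  rewrite -mulr_suml -num_occE; congr (_ * _).
  rewrite exchange_big /=; apply: eq_bigr => tau _.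
  by rewrite -mulr_suml -num_occE.
pose B (a : {ffun 'I_k -> 'I_n}) :=
  [set b : {ffun 'I_k -> 'I_n} | (s <= #|[set i | b i \in codom a]|)%N].
have V0 : 0 <= V by rewrite mulr_ge0 // sumr_ge0.
have bool1 (b : bool) (x : R) : `|b%:R * x| <= `|x|.
  by rewrite normrM; case: b; rewrite ?normr1 ?mul1r // normr0 mul0r.
have GV a b : `|G a b| <= V.
  apply: le_trans (ler_norm_sum _ _ _) _.
  apply: (@le_trans _ _ (\sum_(pi : 'S_n) \sum_tau `|v tau|)).
    apply: ler_sum => pi _; apply: le_trans (bool1 _ _) _.
    by apply: le_trans (ler_norm_sum _ _ _) _; apply: ler_sum.
  by rewrite sumr_const card_Sn /V mulr_natl.
have G0 a b : increasing b -> b \notin B a -> G a b = 0.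
  move=> incb; rewrite inE -ltnNge => lts.
  (* D collects the indices of b outside a; fewer than s shared positions means #|D| > k - s. *)
  apply: (@sum_induces_eq0 _ _ _ _ _ _ _ [set i | b i \notin codom a]).
  - move=> t; apply: v0; rewrite -(ltn_add2l s) subnKC //.
    have := cardsC [set i | b i \in codom a]; rewrite card_ord => {1}<-.
    rewrite (_ : ~: _ = [set i | b i \notin codom a]) ?ltn_add2r //.
    by apply/setP => i; rewrite !inE.
  - exact: increasing_inj.
  - by move=> i j bi; rewrite inE bi codom_f.
apply: le_trans (ler_norm_sum _ _ _) _.
apply: (@le_trans _ _ (\sum_(a : {ffun 'I_k -> 'I_n})
    (2 ^ k * (k ^ k * n ^ (k - s)))%:R * V)).
  rewrite big_mkcond /=; apply: ler_sum => a _.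
  case: ifP => _; last by rewrite mulr_ge0.
  apply: le_trans (ler_norm_sum _ _ _) _.
  apply: (@le_trans _ _ (\sum_(b in B a) V)).
    rewrite big_mkcond [leRHS]big_mkcond; apply: ler_sum => b _.
    case: ifP => [/G0 incb|_]; last by case: ifP.
    by case: ifPn => [_|/incb ->]; rewrite ?normr0.
  rewrite sumr_const -[V *+ _]mulr_natl; apply: ler_wpM2r => //.
  by rewrite ler_nat card_overlap.
rewrite sumr_const card_ffun !card_ord.
by rewrite [X in _ <= X * _]natrM -mulrA !mulr_natl.
Qed.

(** Each factor n - i of the falling factorial, i < k, is at least n / 2. *)
Lemma expn_le_bin (n k : nat) : (k.*2 <= n)%N ->
  (n ^ k <= 2 ^ k * k`! * 'C(n, k))%N.
Proof.
move=> kn; rewrite -mulnA [(k`! * _)%N]mulnC bin_ffact ffact_prod.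
have -> : (n ^ k = \prod_(i < k) n)%N by rewrite prod_nat_const card_ord.
have -> : (2 ^ k = \prod_(i < k) 2)%N by rewrite prod_nat_const card_ord.
rewrite -big_split; apply: leq_prod => i _ /=.
by have := ltn_ord i; lia.
Qed.

(** The powers n^k, n^(k-s) and n^s multiply to n^(2k), which the square of the binomial coefficient
    absorbs, leaving a bound independent of n. *)
Lemma density_moment_le (R : realType) (k n s : nat) (v : 'S_k -> R)
    (sigma : 'S_k) :
  (0 < n)%N -> (k.*2 <= n)%N -> (s <= k)%N ->
  (forall (D : {set 'I_k}) t, (k - s < #|D|)%N ->
    \sum_(g in Sym D) v (g * t)%g = 0) ->
  `|(n`!%:R)^-1 * \sum_(pi : 'S_n) density R sigma pi *
      (\sum_tau density R tau pi * v tau)| * n%:R ^+ s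
  <= (2 ^ k * k`!)%:R ^+ 2 * (2 ^ k * k ^ k)%:R * \sum_tau `|v tau|.
Proof.
move=> n0 kn sk v0.
have := num_occ_moment_le sigma n0 sk v0.
set S := \sum_(pi : 'S_n) _; set V := \sum_tau `|v tau| => SV.
have -> : \sum_(pi : 'S_n) density R sigma pi *
    (\sum_tau density R tau pi * v tau) = S / 'C(n, k)%:R ^+ 2.
  rewrite /S mulr_suml; apply: eq_bigr => pi _.
  rewrite /density expr2 invfM mulrACA; congr (_ * _).
  by rewrite mulr_suml; apply: eq_bigr => tau _; rewrite mulrAC.
have C0 : 0 < 'C(n, k)%:R :> R.
  by rewrite ltr0n bin_gt0 (leq_trans _ kn) // -addnn leq_addr.
have f0 : 0 < n`!%:R :> R by rewrite ltr0n fact_gt0.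
have V0 : 0 <= V by rewrite sumr_ge0.
have := expn_le_bin kn; rewrite -(ler_nat R) natrM => nC.
have nC2 : (n ^ k)%:R ^+ 2 <= ((2 ^ k * k`!)%:R * 'C(n, k)%:R) ^+ 2 :> R.
  by rewrite lerXn2r ?nnegrE ?mulr_ge0.
rewrite !normrM !normfV (gtr0_norm f0) normrX (gtr0_norm C0).
rewrite mulrA mulrAC ler_pdivrMr ?exprn_gt0 // -[leLHS]mulrA ler_pdivrMl //.
apply: le_trans (ler_wpM2r _ SV) _; first by rewrite exprn_ge0.
have -> : (n ^ k * (2 ^ k * (k ^ k * n ^ (k - s))))%:R * (n`!%:R * V) *
    n%:R ^+ s =
    n`!%:R * (2 ^ k * k ^ k)%:R * V * (n ^ k)%:R ^+ 2 :> R.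
  have nk : (n ^ k = n ^ (k - s) * n ^ s)%N by rewrite -expnD subnK.
  by rewrite -natrX nk !natrM; ring.
apply: le_trans (ler_wpM2l _ nC2) _; first by rewrite !mulr_ge0.
by rewrite le_eqVlt; apply/orP; left; apply/eqP; ring.
Qed.

(** * Passage to the limit *)

Local Open Scope classical_set_scope.
Local Open Scope ring_scope.

Lemma cvg_mx0 (R : realType) (m p : nat) (F : nat -> 'M[R]_(m, p)) :
  (forall i j, F n i j @[n --> \oo] --> (0 : R)) ->
  F n @[n --> \oo] --> (0 : 'M[R]_(m, p)).
Proof.
move=> F0; apply/cvgr0Pnorm_le => e e0.
have : \forall n \near \oo, forall ij : 'I_m * 'I_p, `|F n ij.1 ij.2| <= e.
  apply: filter_forall => -[i j] /=.
  by have /cvgr0Pnorm_le/(_ e e0) := F0 i j.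
apply: filterS => n Fn; rewrite /Num.norm /= mx_normrE.
by apply/bigmax_leP; split=> [|ij _]; [exact: ltW | exact: Fn].
Qed.

(** Since r and s are integers, r + 1 <= s, so (r + s)/2 <= s - 1/2. *)
Lemma powR_half_mul (R : realType) (r s : nat) (x : R) : (r < s)%N -> 1 <= x ->
  x `^ (r%:R / 2) * x `^ (s%:R / 2) <= x ^+ s * (Num.sqrt x)^-1.
Proof.
move=> rs x1; have x0 : 0 < x by exact: lt_le_trans x1.
have xn0 : x != 0 by rewrite gt_eqF.
rewrite -powRD ?xn0 ?implybT //.
rewrite -powR_mulrn ?(ltW x0) // -powR12_sqrt ?(ltW x0) // -powRN.
rewrite -powRD ?xn0 ?implybT //.
apply: ler_powR => //.
have : r%:R + 1 <= s%:R :> R by rewrite natr1 ler_nat.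
lra.
Qed.

Lemma cvg_inv_sqrt (R : realType) :
  (Num.sqrt (n%:R : R))^-1 @[n --> \oo] --> (0 : R).
Proof.
apply/cvgr0Pnorm_le => e e0; near=> n.
have n1 : 0 < n%:R :> R.
  by rewrite ltr0n; near: n; exact: nbhs_infty_ge.
rewrite ger0_norm ?invr_ge0 ?sqrtr_ge0 //.
rewrite invf_ple ?posrE ?sqrtr_gt0 // -[leLHS]gtr0_norm ?invr_gt0 // -sqrtr_sqr.
rewrite ler_wsqrtr //; near: n; exact: nbhs_infty_ger.
Unshelve. all: by end_near.
Qed.

Theorem theorem2 (R : realType) (r s k : nat) (hrs : (r < s)%N) (hsk : (s < k)%N) :
  (fun n : nat =>
     uniform_mean (fun pi : 'S_n =>
       (n%:R `^ (r%:R / 2) *: (orth_proj (Vsub R k r) *m profile R k pi))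
       *m (n%:R `^ (s%:R / 2) *: (orth_proj (Vsub R k s) *m profile R k pi))^T))
  @ \oo --> (0 : 'M[R]_(#|{perm 'I_k}|, #|{perm 'I_k}|)).
Proof.
set Pr := orth_proj _; set Ps := orth_proj _.
(* [M n z j] is E[P_sigma <P, v>], with sigma the permutation of index z and v the j-th column of
   [Ps]. *)
pose M n (z j : 'I_#|{perm 'I_k}|) := (n`!%:R)^-1 *
  \sum_(pi : 'S_n) density R (enum_val z) pi *
    (\sum_tau density R tau pi * Ps (enum_rank tau) j).
pose c n : R := n%:R `^ (r%:R / 2) * n%:R `^ (s%:R / 2).
apply: cvg_mx0 => i j.
rewrite (_ : (fun n => _) =
  (fun n => \sum_z Pr i z * (c n * M n z j))); last first.
  apply/funext => n; rewrite /uniform_mean mxE summxE.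
  transitivity (\sum_z \sum_(pi : 'S_n) (n`!%:R)^-1 * c n *
      (Pr i z * (density R (enum_val z) pi *
        (\sum_tau density R tau pi * Ps (enum_rank tau) j)))).
    rewrite exchange_big mulr_sumr; apply: eq_bigr => pi _.
    rewrite -scalemxAl linearZ /= -scalemxAr trmx_mul tr_orth_proj -/Ps.
    rewrite -mulr_sumr scalerA mxE -mulmxA mulrA; congr (_ * _).
    rewrite mxE; apply: eq_bigr => z _; congr (_ * _).
    rewrite mulmxA mxE [RHS]mulr_sumr.
    rewrite (reindex _ (onW_bij _ (enum_rank_bij _))) /=.
    apply: eq_bigr => tau _.
    by rewrite !mxE big_ord1 !mxE enum_rankK mulrA.
  apply: eq_bigr => z _; rewrite /M -!mulr_sumr; ring.
suff : \sum_z Pr i z * (c n * M n z j) @[n --> \oo] -->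
    \sum_(z < #|{perm 'I_k}|) (0 : R).
  by rewrite big1_eq.
apply: cvg_big => [|z _]; first exact: add_continuous.
rewrite -[X in _ --> X](mulr0 (Pr i z)); apply: cvgM; first exact: cvg_cst.
pose K : R := (2 ^ k * k`!)%:R ^+ 2 * (2 ^ k * k ^ k)%:R *
  \sum_(tau : 'S_k) `|Ps (enum_rank tau) j|.
have MK n : (0 < n)%N -> (k.*2 <= n)%N -> `|M n z j| * n%:R ^+ s <= K.
  move=> n0 kn; apply: (density_moment_le _ n0 kn (ltnW hsk)) => D t ltD.
  (* The j-th column of [Ps] is the projection of the j-th basis vector, so it lies in V_s. *)
  have [VP _] := orth_projP (Vsub R k s) (delta_mx j 0).
  rewrite -[RHS](Vsub_sum_Sym t VP ltD); apply: eq_bigr => g _.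
  by rewrite [RHS]mxE -colE [RHS]mxE.
apply/norm_cvg0P.
(* Half a power of n is left over: c_n |M| <= n^s |M| / sqrt n <= K / sqrt n. *)
apply: (@squeeze_cvgr _ _ _ _ (fun=> 0)
  (fun n => K * (Num.sqrt (n%:R : R))^-1)).
- near=> n; rewrite normr_ge0 /= normrM.
  have n0 : (0 < n)%N by near: n; exact: nbhs_infty_ge.
  have kn : (k.*2 <= n)%N by near: n; exact: nbhs_infty_ge.
  have n1 : 1 <= n%:R :> R by rewrite ler1n.
  rewrite ger0_norm ?mulr_ge0 ?powR_ge0 //.
  apply: le_trans (ler_wpM2r (normr_ge0 _) (powR_half_mul hrs n1)) _.
  rewrite mulrAC; apply: ler_wpM2r; first by rewrite invr_ge0 sqrtr_ge0.
  by rewrite mulrC; exact: MK.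
- exact: cvg_cst.
- rewrite -[X in _ --> X](mulr0 K); apply: cvgM; first exact: cvg_cst.
  exact: cvg_inv_sqrt.
Unshelve. all: by end_near.
Qed.
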